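(* Let $T$ be an additive subsemigroup of $\mathbb{R}$ and let $S$ be a convex subset of $T$ containing zero. Then the universal Urysohn metric space $\mathbb{U}_S$ whose distance takes values in $S$ has the Hrushovski--Solecki--Vershik property.
   Context: A subset $S$ of a totally ordered set $T$ is convex if for all $x,y,z\in T$ the conditions $x\le y\le z$ and $x,z\in S$ imply $y\in S$. Here $T$ carries the order of $\mathbb{R}$. $\mathbb{U}_S$ denotes the version of the universal Urysohn metric space with distance values in $S$, characterized by the following properties: all distances lie in $S$; it is complete and separable; it is ultrahomogeneous (every isometry between finite subspaces extends to a global self-isometry of the space); and it is universal for separable metric spaces with distance values in $S$ (it contains an isometric copy of each of them). A metric space $X$ has the Hrushovski--Solecki--Vershik property if for every finite subspace $Y$ of $X$ there exists a finite $Z$ with $Y\subseteq Z\subseteq X$ such that every partial isometry of $Y$ (an isometry between two subspaces of $Y$) extends to a self-isometry of $Z$. *)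

(* Defs.v *)
From HB Require Import structures.
From mathcomp Require Import all_boot all_order all_algebra.
From mathcomp Require Import all_classical all_reals all_analysis.

Set Implicit Arguments.
Unset Strict Implicit.
Unset Printing Implicit Defensive.

Import Order.TTheory GRing.Theory Num.Theory.

Local Open Scope classical_set_scope.
Local Open Scope ring_scope.

Definition additive_subsemigroup (R : realType) (T : set R) : Prop :=
  forall x y, T x -> T y -> T (x + y).

(* Convexity is relative to the ordered set T, not to R: points outside T are
   not required to lie in S. *)
Definition convex_subset (R : realType) (T S : set R) : Prop :=
  S `<=` T /\
  forall x y z, T x -> T y -> T z -> x <= y -> y <= z -> S x -> S z -> S y.

Definition distances_in (R : realType) (S : set R) (X : metricType R) : Prop :=
  forall x y : X, S (mdist x y).

(* The axiom of completeType, as a predicate on a possibly empty space. *)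
Definition complete_space (X : uniformType) : Prop :=
  forall F : set_system X, ProperFilter F -> cauchy F -> exists x : X, F --> x.

Definition separable_space (X : topologicalType) : Prop :=
  exists2 D : set X, countable D & dense D.

(* f restricts to an isometry of the subspace A onto the subspace B; the values
   of f outside A are irrelevant. *)
Definition isometry_onto (R : realType) (X Y : metricType R)
    (A : set X) (B : set Y) (f : X -> Y) : Prop :=
  set_bij A B f /\
  forall x y, A x -> A y -> mdist (f x) (f y) = mdist x y.

Definition ultrahomogeneous (R : realType) (X : metricType R) : Prop :=
  forall (A B : set X) (f : X -> X),
    finite_set A -> finite_set B -> isometry_onto A B f ->
    exists g : X -> X,
      isometry_onto [set: X] [set: X] g /\ (forall x, A x -> g x = f x).

Definition universal_for (R : realType) (S : set R) (X : metricType R) : Prop :=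
  forall Y : metricType R, separable_space Y -> distances_in S Y ->
    exists (A : set X) (f : Y -> X), isometry_onto [set: Y] A f.

Record is_Urysohn_space (R : realType) (S : set R) (X : metricType R) : Prop := {
  Urysohn_distances : distances_in S X;
  Urysohn_complete : complete_space X;
  Urysohn_separable : separable_space X;
  Urysohn_ultrahomogeneous : ultrahomogeneous X;
  Urysohn_universal : universal_for S X
}.

Definition Hrushovski_Solecki_Vershik (R : realType) (X : metricType R) : Prop :=
  forall Y : set X, finite_set Y ->
    exists Z : set X,
      [/\ finite_set Z, Y `<=` Z &
        forall (A B : set X) (f : X -> X),
          A `<=` Y -> B `<=` Y -> isometry_onto A B f ->
          exists g : X -> X,
            isometry_onto Z Z g /\ (forall x, A x -> g x = f x)].

(* Main.v *)
Require Import Defs.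
From HB Require Import structures.
From mathcomp Require Import all_boot all_order all_algebra all_fingroup.
From mathcomp Require Import lra zify.
From mathcomp Require Import all_classical all_reals all_analysis.

(** The proof first shows a statement about finite spaces: every finite metric
space [A] with distances in [S] embeds in a finite metric space [B] with
distances in [S] such that every partial isometry of [A] extends to an isometry
of [B] ([finite_metric_extension]).  Universality then places a copy of [B]
inside the Urysohn space, and ultrahomogeneity moves that copy so that its part
[A] coincides with the given finite set [Y]; the moved copy of [B] is the
required [Z].

The finite statement follows Hubicka, Konecny and Nesetril.  Instead of metric
spaces one works with finite weighted graphs: symmetric functions [w], where
[w x y = 0] means that [x] and [y] are not joined and all weights are distances
of [A].  If no walk in such a graph is shorter than the weight between its
ends, the path metric truncated at the largest distance [M] of [A] agrees with
[w] on edges, and it is preserved by every automorphism.  Its nonzero values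
are [M] and sums of distances of [A] lying between a distance of [A] and [M],
so they belong to [T] because [T] is closed under addition, and to [S] because
[S] is convex in [T].

It remains to build a graph around [A] with enough automorphisms and without
shortcuts. A walk with [n] edges has length at least [n] times the least
positive distance of [A], so only walks with boundedly many edges can be too
short. The graph of [base_extension] has all required automorphisms but may
have shortcuts. The step [unroll] removes the shortcuts that have [n.+1] edges,
given that there are none with at most [n] edges. It replaces every vertex [x]
by pairs [(x, u)], where [u] attaches a bit to each walk with [n.+1] edges. Two
pairs are joined only if, for every such walk [c] that is a shortcut and passes
through both vertices, their bits at [c] differ exactly when the two vertices
are the ends of [c]; the weight is that of the old edge. In a lift of [c]
itself the bit would stay constant along [c] but change between its ends, so
[c] does not lift. An automorphism of the old graph lifts to the new one in
many ways, because flipping the bits at [c] of all vertices on [c] preserves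
the adjacency rule; this freedom is what allows extending partial isometries of
[A]. *)

Set Implicit Arguments.
Unset Strict Implicit.
Unset Printing Implicit Defensive.

Import Order.TTheory GRing.Theory Num.Theory.

Local Open Scope ring_scope.

(** * Walks in weighted graphs *)

Section Walks.
Context (R : realFieldType) (V : eqType) (w : V -> V -> R).

Definition edge : rel V := fun x y => 0 < w x y.

Fixpoint walk_length (x : V) (s : seq V) : R :=
  if s is y :: s' then w x y + walk_length y s' else 0.

Definition no_shortcut (n : nat) : Prop :=
  forall x s, (size s <= n)%N -> path edge x s ->
  w x (last x s) <= walk_length x s.

Lemma walk_length_cat x s t :
  walk_length x (s ++ t) = walk_length x s + walk_length (last x s) t.
Proof. by elim: s x => [|y s IH] x /=; rewrite ?add0r// IH addrA. Qed.

Hypothesis w_sym : forall x y, w x y = w y x.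

Lemma edge_sym : symmetric edge.
Proof. by move=> x y; rewrite /edge w_sym. Qed.

Lemma walk_length_rev x s :
  walk_length (last x s) (rev (belast x s)) = walk_length x s.
Proof.
elim: s x => [|y s IH] x //=.
rewrite rev_cons -cats1 walk_length_cat IH /= addr0 addrC.
congr (_ + _).
by case: s {IH} => [|z s] /=; rewrite ?rev_cons ?last_rcons w_sym.
Qed.

Lemma path_rev x s :
  path edge x s -> path edge (last x s) (rev (belast x s)).
Proof.
by rewrite rev_path (@eq_path _ _ edge)// => u v; rewrite /= edge_sym.
Qed.

Lemma last_rev_belast (x : V) (s : seq V) :
  last (last x s) (rev (belast x s)) = x :> V.
Proof. by case: s => [|y s] //=; rewrite rev_cons last_rcons. Qed.

Lemma walk_length_ge0 x s : path edge x s -> 0 <= walk_length x s.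
Proof.
elim: s x => //= y s IH x /andP[xy ys].
by rewrite addr_ge0 ?IH// ltW.
Qed.

(** This bound is what makes it enough to exclude shortcuts with boundedly many
edges. *)
Lemma walk_length_ge (delta : R) x s :
  (forall u v, edge u v -> delta <= w u v) ->
  path edge x s -> delta *+ size s <= walk_length x s.
Proof.
move=> dle; elim: s x => [|y s IH] x //= /andP[xy ys].
by rewrite mulrS lerD ?IH ?dle.
Qed.

End Walks.

(** * Finite metric spaces and extension of partial isometries *)

Record finite_metric (R : realFieldType) (V : Type) (d : V -> V -> R) : Prop :=
  FiniteMetric {
  fm_refl : forall x, d x x = 0;
  fm_eq0 : forall x y, d x y = 0 -> x = y;
  fm_sym : forall x y, d x y = d y x;
  fm_triangle : forall y x z, d x z <= d x y + d y z
}.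

Lemma fm_ge0 (R : realFieldType) (V : Type) (d : V -> V -> R) :
  finite_metric d -> forall x y, 0 <= d x y.
Proof.
move=> [d0 _ ds dt] x y; have := dt y x x; rewrite d0 (ds y x).
by lra.
Qed.

Lemma partial_isometry_inj (R : realFieldType) (A : finType) (d : A -> A -> R)
    (D : {set A}) (f : A -> A) : finite_metric d ->
  {in D &, forall a b, d (f a) (f b) = d a b} -> {in D &, injective f}.
Proof.
move=> dM fD a b aD bD fab; apply: (fm_eq0 dM).
by rewrite -fD// fab (fm_refl dM).
Qed.

(** The weight [0] encodes the absence of an edge. *)
Record weighted_by (R : realFieldType) (A : Type) (d : A -> A -> R)
    (B : Type) (w : B -> B -> R) : Prop := WeightedBy {
  wb_sym : forall x y, w x y = w y x;
  wb_refl : forall x, w x x = 0;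
  wb_values : forall x y, w x y = 0 \/ exists a b, w x y = d a b
}.

(** In the terminology of the literature, [(B, w)] is an EPPA witness for
[(A, d)]: the acronym stands for the extension property for partial
automorphisms. *)
Record extends_isometries (R : realFieldType) (A : finType) (d : A -> A -> R)
    (B : finType) (w : B -> B -> R) (i : A -> B) : Prop := ExtendsIsometries {
  ei_embed : forall a b, w (i a) (i b) = d a b;
  ei_extend : forall (D : {set A}) (f : A -> A),
    {in D &, forall a b, d (f a) (f b) = d a b} ->
    exists2 g : {perm B}, (forall x y, w (g x) (g y) = w x y) &
      {in D, forall a, g (i a) = i (f a)}
}.

(** * Removing the shortcuts with one more edge *)

Section Unroll.
Context (R : realFieldType) (A : finType) (d : A -> A -> R).
Context (B : finType) (w : B -> B -> R) (i : A -> B) (n : nat).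
Hypothesis dM : finite_metric d.
Hypothesis wG : weighted_by d w.
Hypothesis wE : extends_isometries d w i.
Hypothesis wn : no_shortcut w n.

Let cand : finType := (B * (n.+1).-tuple B)%type.
Implicit Type c : cand.

Let onwalk c : seq B := c.1 :: c.2.

Let shortcut c : bool :=
  path (edge w) c.1 c.2 && (walk_length w c.1 c.2 < w c.1 (last c.1 c.2)).

Let ends c x y : bool :=
  ((x == c.1) && (y == last c.1 c.2)) || ((y == c.1) && (x == last c.1 c.2)).

(** Each vertex carries a bit for every candidate walk, whether or not it lies on
that walk: the vertex set is then a plain product and needs no dependent
types. *)
Let V : finType := (B * {ffun cand -> bool})%type.
Implicit Type p q : V.

(** Going once around the closed walk made of [c] and the edge between its ends,
the bits at [c] of a lift would have to change exactly once. *)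
Let compat p q : bool :=
  [forall c, [&& shortcut c, p.1 \in onwalk c & q.1 \in onwalk c] ==>
     (p.2 c (+) q.2 c == ends c p.1 q.1)].

Let w' p q : R := if compat p q then w p.1 q.1 else 0.

(** The rule forces distinct points of [A] that lie on a shortcut [c] to have
equal bits at [c] unless they are the two ends of [c].  This choice makes one
bit equal to [1], at the first vertex of [c], precisely when both ends of [c]
are in [A]. *)
Let chi (a : A) : {ffun cand -> bool} :=
  [ffun c => [&& shortcut c, i a == c.1 & last c.1 c.2 \in codom i]].

Let i' (a : A) : V := (i a, chi a).

Let i_inj : injective i.
Proof.
move=> a b iab; apply: (fm_eq0 dM).
by rewrite -(ei_embed wE) iab (wb_refl wG).
Qed.

Let ends_sym c x y : ends c x y = ends c y x.
Proof. by rewrite /ends orbC. Qed.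

Let compat_sym p q : compat p q = compat q p.
Proof.
apply: eq_forallb => c; rewrite addbC ends_sym; congr (_ ==> _).
by rewrite [(p.1 \in _) && _]andbC.
Qed.

(** If both ends of [c] and an interior vertex lie in [A], then cutting [c] at
this vertex gives two walks with at most [n] edges, which are no shortcuts; the
triangle inequality in [A] then shows that [c] is no shortcut either. *)
Let codom_onwalk_ends c a : shortcut c -> i a \in onwalk c ->
  c.1 \in codom i -> last c.1 c.2 \in codom i -> i a = c.1 \/ i a = last c.1 c.2.
Proof.
case: c => x s; rewrite /shortcut /onwalk /= => /andP[ps lts].
rewrite inE => /orP[/eqP->|]; first by left.
move=> ias /codomP[b xb] /codomP[b' lb'].
have := size_tuple s; case/splitPr: ias ps lts lb' => s1 s2.
rewrite last_cat /= size_cat /= cat_path /=.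
move=> /andP[p1 /andP[e1 p2]] + lb' ss.
rewrite lb' walk_length_cat /= ltNge => /negP + .
case: s2 p2 lb' ss => [|y s2] p2 lb' ss; first by right.
case; rewrite xb !(ei_embed wE).
apply: le_trans (fm_triangle dM a _ _) _.
rewrite -!(ei_embed wE) -xb -lb' addrA.
have h1 := @wn x (rcons s1 (i a)); have h2 := @wn (i a) (y :: s2).
rewrite -cats1 cat_path last_cat walk_length_cat /= p1 e1 size_cat /= in h1.
rewrite addr0 in h1; apply: lerD; first by apply: h1 => //=; move: ss => /=; lia.
by apply: h2 => //=; move: ss => /=; lia.
Qed.

Let shortcut_ends_neq c : shortcut c -> c.1 != last c.1 c.2.
Proof.
case/andP => ps; apply: contraTneq => <-.
by rewrite (wb_refl wG) -leNgt walk_length_ge0.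
Qed.

(** If the bit of [a] is [1], then [i a] is the first vertex of [c] and the last
one lies in [A], so by [codom_onwalk_ends] the other point [b] is the last. *)
Let chi_ends c a b : shortcut c -> a != b ->
  i a \in onwalk c -> i b \in onwalk c ->
  chi a c (+) chi b c = ends c (i a) (i b).
Proof.
move=> bc ab ac bc'; rewrite !ffunE bc /= /ends.
have nab : i a != i b by rewrite (inj_eq i_inj).
have ne := shortcut_ends_neq bc.
have [lc|nlc] := boolP (last c.1 c.2 \in codom i); last first.
  rewrite !andbF /=; apply/esym/negbTE/norP; split;
    by apply: contra nlc => /andP[_ /eqP<-]; exact: codom_f.
rewrite !andbT.
have [iac|iac] := eqVneq (i a) c.1; have [ibc|ibc] := eqVneq (i b) c.1 => //=.
- by move: nab; rewrite iac ibc eqxx.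
- have [] := codom_onwalk_ends bc bc' _ lc; first by rewrite -iac codom_f.
    by move/eqP; rewrite (negbTE ibc).
  by move=> ->; rewrite eqxx.
- have [] := codom_onwalk_ends bc ac _ lc; first by rewrite -ibc codom_f.
    by move/eqP; rewrite (negbTE iac).
  by move=> ->; rewrite eqxx.
Qed.

Let w'_embed a b : w' (i' a) (i' b) = d a b.
Proof.
rewrite /w' /= (ei_embed wE).
have [->|ab] := eqVneq a b; first by rewrite (fm_refl dM) if_same.
rewrite ifT//; apply/forallP => c; apply/implyP => /and3P[bc ac bc'].
by rewrite chi_ends.
Qed.

(** Lifting an automorphism [g] that extends a partial isometry [f] of [A] to
one of the unrolled graph that does the same. *)
Section Lift.
Variables (D : {set A}) (f : A -> A) (g : {perm B}).
Hypothesis fD : {in D &, forall a b, d (f a) (f b) = d a b}.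
Hypothesis gw : forall x y, w (g x) (g y) = w x y.
Hypothesis gf : {in D, forall a, g (i a) = i (f a)}.

Let act c : cand := (g c.1, map_tuple g c.2).
Let gV : {perm B} := (g^-1)%g.
Let act_inv c : cand := (gV c.1, map_tuple gV c.2).

Let act_invK : cancel act_inv act.
Proof.
move=> [x s]; rewrite /act /act_inv /= permKV; congr pair.
by apply/val_inj; rewrite /= -map_comp map_id_in// => y _ /=; rewrite permKV.
Qed.

Let actK : cancel act act_inv.
Proof.
move=> [x s]; rewrite /act /act_inv /= permK; congr pair.
by apply/val_inj; rewrite /= -map_comp map_id_in// => y _ /=; rewrite permK.
Qed.

Let path_act x s : path (edge w) (g x) (map g s) = path (edge w) x s.
Proof. by elim: s x => //= y s IH x; rewrite IH /edge gw. Qed.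

Let length_act x s : walk_length w (g x) (map g s) = walk_length w x s.
Proof. by elim: s x => //= y s IH x; rewrite IH gw. Qed.

Let shortcut_act c : shortcut (act c) = shortcut c.
Proof. by rewrite /shortcut /= path_act length_act last_map gw. Qed.

Let onwalk_act c x : (g x \in onwalk (act c)) = (x \in onwalk c).
Proof.
by rewrite /onwalk /= -[g c.1 :: _]/(map g (c.1 :: c.2)) (mem_map (@perm_inj _ g)).
Qed.

Let ends_act c x y : ends (act c) (g x) (g y) = ends c x y.
Proof. by rewrite /ends /= last_map !(inj_eq (@perm_inj _ g)). Qed.

(** The walks at which the bits must be flipped for the lift to send [i' a] to
[i' (f a)]; by [flipE] all points [a] of [D] on [c] agree on this. *)
Let flip c : bool :=
  [exists a in D, (i a \in onwalk c) && (chi a c != chi (f a) (act c))].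

Let lift p : V :=
  (g p.1, [ffun c => p.2 (act_inv c) (+)
                     (flip (act_inv c) && (p.1 \in onwalk (act_inv c)))]).

Let lift_inj : injective lift.
Proof.
move=> [x u] [y v] [/perm_inj <-{y} /ffunP uv]; congr pair.
apply/ffunP => c; have := uv (act c); rewrite !ffunE actK.
exact: addIb.
Qed.

Let w'_lift p q : w' (lift p) (lift q) = w' p q.
Proof.
rewrite /w' /= gw; congr (if _ then _ else _).
rewrite /compat; apply/forallP/forallP => H c.
- have := H (act c); rewrite shortcut_act !onwalk_act !ffunE actK ends_act.
  by case: (shortcut c) => //=; case: (p.1 \in _) => //=; case: (q.1 \in _) => //=;
     rewrite !andbT addbACA addbb addbF.
- have := H (act_inv c); rewrite -[in X in _ -> X](act_invK c).
  rewrite shortcut_act !onwalk_act !ffunE actK ends_act.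
  by case: (shortcut _) => //=; case: (p.1 \in _) => //=; case: (q.1 \in _) => //=;
     rewrite !andbT addbACA addbb addbF.
Qed.

Let f_inj : {in D &, injective f} := partial_isometry_inj dM fD.

(** Two points [a], [b] of [D] on [c] cannot disagree: the sum of their bits only
depends on whether they are the ends of [c], and [g] carries ends to ends. *)
Let flipE c a : a \in D -> i a \in onwalk c ->
  flip c = (chi a c != chi (f a) (act c)).
Proof.
move=> aD ac; apply/idP/idP; last first.
  by move=> h; apply/existsP; exists a; rewrite aD ac.
case/existsP => b /and3P[bD bc]; have [->//|ab] := eqVneq a b.
have [sc|nsc] := boolP (shortcut c); last first.
  by rewrite !ffunE shortcut_act (negbTE nsc).
have iE x : x \in D -> i (f x) \in onwalk (act c) = (i x \in onwalk c).
  by move=> xD; rewrite -gf// onwalk_act.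
have := chi_ends sc ab ac bc.
rewrite -ends_act !gf// -chi_ends ?shortcut_act ?iE//; last first.
  by apply: contra ab => /eqP /f_inj -> //.
by case: (chi a c); case: (chi b c); case: (chi (f a) _); case: (chi (f b) _).
Qed.

Let lift_embed : {in D, forall a, lift (i' a) = i' (f a)}.
Proof.
move=> a aD; congr pair; first exact: gf.
apply/ffunP => c; rewrite -(act_invK c); move: (act_inv c) => {}c.
rewrite ffunE actK /=.
have [ac|nac] := boolP (i a \in onwalk c).
  by rewrite (flipE aD ac) andbT; do 2! case: (chi _ _).
rewrite andbF addbF !ffunE shortcut_act /=; move: nac.
by rewrite -gf// (inj_eq (@perm_inj _ g)) inE negb_or => /andP[/negbTE -> _].
Qed.

Lemma lift_extension : exists2 h : {perm V},
  (forall p q, w' (h p) (h q) = w' p q) & {in D, forall a, h (i' a) = i' (f a)}.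
Proof.
exists (perm lift_inj) => [p q|a aD]; rewrite !permE; first exact: w'_lift.
exact: lift_embed.
Qed.

End Lift.

Let w'_weighted : weighted_by d w'.
Proof.
split.
- by move=> p q; rewrite /w' compat_sym (wb_sym wG).
- by move=> p; rewrite /w' (wb_refl wG) if_same.
- move=> p q; rewrite /w'; case: ifP => _; last by left.
  exact: (wb_values wG).
Qed.

Let w'_extends : extends_isometries d w' i'.
Proof.
split.
- exact: w'_embed.
- move=> D f fD; have [g gw gf] := ei_extend wE fD.
  exact: lift_extension fD gw gf.
Qed.

Let edge_proj p q : edge w' p q -> compat p q /\ edge w p.1 q.1.
Proof. by rewrite /edge /w'; case: ifP => // _; rewrite ltxx. Qed.

Let path_proj p s : path (edge w') p s ->
  path (edge w) p.1 (map fst s) /\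
  walk_length w' p s = walk_length w p.1 (map fst s).
Proof.
elim: s p => //= q s IH p /andP[/edge_proj[pq e] /IH[h1 h2]].
by rewrite e h1 h2 /w' pq.
Qed.

(** Along a walk shorter than the weight between the ends of the shortcut [c], no
edge can join these ends, so the rule keeps the bit at [c] constant. *)
Let chi_const c p s : shortcut c -> path (edge w') p s ->
  {subset map fst (p :: s) <= onwalk c} ->
  walk_length w' p s < w c.1 (last c.1 c.2) -> p.2 c = (last p s).2 c.
Proof.
move=> bc; elim: s p => //= q s IH p /andP[pq qs] sub lts.
have [/forallP/(_ c) cpq _] := edge_proj pq.
have wqs := walk_length_ge0 qs.
rewrite -IH//; first last.
- by apply: le_lt_trans lts; rewrite lerDr ltW.
- by move=> x xs; apply: sub; rewrite inE xs orbT.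
move: cpq; rewrite bc !sub ?inE ?eqxx ?orbT//= => /eqP.
rewrite [ends _ _ _]negbTE; first by case: (p.2 c); case: (q.2 c).
apply/negP => en; move: lts; apply/negP; rewrite -leNgt.
have [/forallP cpq e] := edge_proj pq.
suff -> : w c.1 (last c.1 c.2) = w' p q by rewrite lerDl.
rewrite /w' ifT//; last exact/forallP.
by case/orP: en => /andP[/eqP <- /eqP <-]//; rewrite (wb_sym wG).
Qed.

(** A shortcut of the unrolled graph projects to a shortcut [c] of the old one, so
it cannot have at most [n] edges.  If it has [n.+1] edges, then by [chi_const]
its ends have the same bit at [c], whereas the rule for the edge between these
ends requires different bits. *)
Lemma no_shortcut_unroll : no_shortcut w' n.+1.
Proof.
move=> p s sn ps; rewrite leNgt; apply/negP => lts.
have e : edge w' p (last p s) by apply: le_lt_trans lts; exact: walk_length_ge0.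
have [/forallP cpl _] := edge_proj e.
have [ps' len] := path_proj ps.
have wl : w' p (last p s) = w p.1 (last p.1 (map fst s)).
  by rewrite /w' ifT ?last_map//; apply/forallP.
rewrite wl len in lts.
have [sn'|sn'] := leqP (size s) n.
  by move: lts; rewrite ltNge wn// size_map.
have sz : size (map fst s) == n.+1 by rewrite size_map eqn_leq sn sn'.
pose c : cand := (p.1, Tuple sz).
have bc : shortcut c by rewrite /shortcut /= ps' lts.
have sub : {subset map fst (p :: s) <= onwalk c} by [].
have lc : (last p s).1 \in onwalk c.
  by apply: sub; rewrite map_f// mem_last.
have := chi_const bc ps sub; rewrite len => /(_ lts) pl.
have := cpl c; rewrite bc lc (sub p.1) ?inE ?eqxx//= pl addbb.
by rewrite /ends /= last_map !eqxx.
Qed.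

Lemma unroll : exists (C : finType) (wC : C -> C -> R) (j : A -> C),
  [/\ weighted_by d wC, extends_isometries d wC j & no_shortcut wC n.+1].
Proof.
by exists V, w', i'; split => //; exact: no_shortcut_unroll.
Qed.

End Unroll.

(** * A finite graph with enough automorphisms *)

(** The complements of [D] and of its image have the same size, so their
enumerations match them. *)
Lemma perm_extension (A : finType) (D : {set A}) (f : A -> A) :
  {in D &, injective f} -> exists g : {perm A}, {in D, g =1 f}.
Proof.
move=> f_inj.
have szC : size (enum (~: D)) = size (enum (~: (f @: D))).
  rewrite -!cardE; apply: (@addnI #|D|).
  by rewrite cardsC -{1}(card_in_imset f_inj) cardsC.
pose h x := if x \in D then f x
            else nth x (enum (~: (f @: D))) (index x (enum (~: D))).
have hC x : x \notin D -> h x \notin f @: D.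
  move=> xD; rewrite /h (negbTE xD) -finset.in_setC -mem_enum mem_nth// -szC.
  by rewrite index_mem mem_enum finset.in_setC.
have h_inj : injective h.
  move=> x y; have [xD|xD] := boolP (x \in D); have [yD|yD] := boolP (y \in D).
  - by rewrite /h xD yD; exact: f_inj.
  - by move=> e; have := hC _ yD; rewrite -e /h xD imset_f.
  - by move=> e; have := hC _ xD; rewrite e /h yD imset_f.
  - have idx z : z \notin D -> (index z (enum (~: D)) < size (enum (~: D)))%N.
      by move=> zD; rewrite index_mem mem_enum finset.in_setC.
    rewrite /h (negbTE xD) (negbTE yD) (set_nth_default x y) -?szC ?idx//.
    move/eqP; rewrite nth_uniq ?enum_uniq -?szC ?idx// => /eqP.
    by apply: (index_inj x); rewrite mem_enum finset.in_setC.
exists (perm h_inj) => x xD; by rewrite permE /h xD.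
Qed.

(** Vertices are pairs [(a, u)] with [u] assigning a label to each point of [A];
the weight between [(a, u)] and [(b, v)] is the distance coded by the sum
[u b + v a] in the cyclic group of labels.  A permutation of [A] acts on such
pairs, and shifting [u b] and [v a] by opposite amounts changes no weight. *)
Section Base.
Context (R : realFieldType) (A : finType) (d : A -> A -> R).
Hypothesis dM : finite_metric d.

Let vals : seq R := [seq d x.1 x.2 | x : A * A].
Let label : zmodType := 'I_(size vals).+1.
Let decode (l : label) : R := nth 0 vals (l : 'I_(size vals).+1).
Let code a b : label := inord (index (d a b) vals).

Let codeK a b : decode (code a b) = d a b.
Proof.
have dv : d a b \in vals by apply/fintype.imageP; exists (a, b).
by rewrite /decode /code inordK ?nth_index// ltnS index_size.
Qed.

Let code_sym a b : code a b = code b a.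
Proof. by rewrite /code (fm_sym dM). Qed.

Let V : finType := (A * {ffun A -> 'I_(size vals).+1})%type.
Implicit Type p q : V.

Let col p b : label := p.2 b.

Let w p q : R :=
  if p.1 == q.1 then 0 else decode (col p q.1 + col q p.1).

(** Of the two summands that make up the label of a pair of points of [A], one
carries the whole label; the enumeration of [A] decides which. *)
Let i (a : A) : V :=
  (a, [ffun b => if (enum_rank a < enum_rank b)%N then code a b else 0]).

Let colE a b : a != b -> col (i a) b + col (i b) a = code a b.
Proof.
move=> ab; rewrite /col /i /= !ffunE.
case: ltngtP => [_|_|/ord_inj/enum_rank_inj e]; first by rewrite addr0.
  by rewrite add0r code_sym.
by rewrite e eqxx in ab.
Qed.

Let w_embed a b : w (i a) (i b) = d a b.
Proof.
rewrite /w /=; case: eqVneq => [->|ab]; first by rewrite (fm_refl dM).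
by rewrite colE// codeK.
Qed.

Section BaseLift.
Variables (D : {set A}) (f : A -> A).
Hypothesis fD : {in D &, forall a b, d (f a) (f b) = d a b}.

Variable g : {perm A}.
Hypothesis gf : {in D, g =1 f}.

Let defect a b : label := col (i (g a)) (g b) - col (i a) b.

(** The correction at [(a, b)] is prescribed for [a] in [D]; elsewhere it is chosen
so that [shift] is antisymmetric off the diagonal.  For [a] and [b] both in [D]
the two prescriptions are opposite since [f] preserves their distance. *)
Let shift a b : label :=
  if a \in D then defect a b else if b \in D then - defect b a else 0.

Let shift_antisym a b : a != b -> shift a b + shift b a = 0.
Proof.
rewrite /shift => ab; have [aD|aD] := boolP (a \in D); have [bD|bD] := boolP (b \in D).
- rewrite /defect addrACA colE; last by rewrite (inj_eq (@perm_inj _ g)).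
  rewrite -opprD colE// /code -(fD aD bD) -!gf//.
  by rewrite subrr.
- by rewrite subrr.
- by rewrite addNr.
- by rewrite addr0.
Qed.

Let lift p : V := (g p.1, [ffun b => col p (g^-1 b)%g + shift p.1 (g^-1 b)%g]).

Let col_lift p b : col (lift p) (g b) = col p b + shift p.1 b.
Proof. by rewrite /col /= ffunE permK. Qed.

Let lift_inj : injective lift.
Proof.
move=> p q pq; have e1 : p.1 = q.1 by move: pq => [/perm_inj].
rewrite [p]surjective_pairing [q]surjective_pairing e1; congr pair.
apply/ffunP => b; apply: (@addIr label (shift p.1 b)).
by rewrite -[LHS]col_lift pq col_lift e1.
Qed.

Let w_lift p q : w (lift p) (lift q) = w p q.
Proof.
rewrite /w (inj_eq (@perm_inj _ g)); case: ifPn => // ne; congr decode.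
by rewrite /= !col_lift addrACA shift_antisym// addr0.
Qed.

Let lift_embed : {in D, forall a, lift (i a) = i (f a)}.
Proof.
move=> a aD; rewrite -gf//; congr pair.
apply/ffunP => b; rewrite -(permKV g b); move: (g^-1 b)%g => {}b.
rewrite -[LHS]/(col (lift (i a)) (g b)) -[RHS]/(col (i (g a)) (g b)) col_lift.
by rewrite /shift /= aD /defect addrC subrK.
Qed.

Lemma base_lift : exists2 h : {perm V},
  (forall p q, w (h p) (h q) = w p q) & {in D, forall a, h (i a) = i (f a)}.
Proof.
exists (perm lift_inj) => [p q|a aD]; rewrite !permE; first exact: w_lift.
exact: lift_embed.
Qed.

End BaseLift.

Lemma base_extension : exists (B : finType) (wB : B -> B -> R) (j : A -> B),
  weighted_by d wB /\ extends_isometries d wB j.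
Proof.
exists V, w, i; split; split.
- by move=> p q; rewrite /w eq_sym [in RHS]addrC.
- by move=> p; rewrite /w eqxx.
- move=> p q; rewrite /w; case: ifP => _; first by left.
  rewrite /decode; set l := nat_of_ord _; have [lt|le] := ltnP l (size vals).
    by have /mapP[[a b] _ /= e] := mem_nth 0 lt; right; exists a, b.
  by left; rewrite nth_default.
- exact: w_embed.
- move=> D f fD.
  have [g gf] := perm_extension (partial_isometry_inj dM fD).
  exact: base_lift fD _ gf.
Qed.

End Base.

Lemma extension_no_shortcut (R : realFieldType) (A : finType) (d : A -> A -> R) :
  finite_metric d -> forall n,
  exists (B : finType) (w : B -> B -> R) (i : A -> B),
    [/\ weighted_by d w, extends_isometries d w i & no_shortcut w n].
Proof.
move=> dM; elim=> [|n [B [w [i [wG wE wn]]]]]; last exact: unroll dM wG wE wn.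
have [B [w [i [wG wE]]]] := base_extension dM; exists B, w, i; split=> //.
by move=> x [|//] _ _ /=; rewrite (wb_refl wG).
Qed.

(** * The truncated path metric *)

Section PathMetric.
Context (R : realFieldType) (V : finType) (w : V -> V -> R).
Context (n : nat) (M delta : R).
Hypothesis w_sym : forall x y, w x y = w y x.
Hypothesis M_gt0 : 0 < M.
Hypothesis delta_gt0 : 0 < delta.
Hypothesis delta_le : forall x y, edge w x y -> delta <= w x y.
Hypothesis M_le : M <= delta *+ n.

(** Only walks with at most [n] edges occur in the minimum; the assumption [M_le]
makes all longer walks at least as long as the truncation value [M], so that
[path_metric_le] holds for walks of every size. *)
Definition path_metric (x y : V) : R :=
  \big[Num.min/M]_(s : n.-bseq V | path (edge w) x s && (last x s == y))
     walk_length w x s.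

Lemma path_metric_leM x y : path_metric x y <= M.
Proof. exact: bigmin_le_id. Qed.

Lemma path_metric_le x s : path (edge w) x s ->
  path_metric x (last x s) <= walk_length w x s.
Proof.
move=> ps; have [sn|sn] := leqP (size s) n.
  by rewrite (bigmin_le_cond _ (j := Bseq sn))//= ps eqxx.
apply: le_trans (path_metric_leM _ _) _; apply: le_trans M_le _.
apply: le_trans (walk_length_ge delta_le ps).
by rewrite ler_wpMn2l ?(ltW delta_gt0)// ltnW.
Qed.

Lemma path_metricP x y : path_metric x y = M \/
  exists s, [/\ path (edge w) x s, last x s = y &
    path_metric x y = walk_length w x s].
Proof.
rewrite /path_metric; elim/big_rec: _ => [|s v /andP[ps /eqP ls] IH]; first by left.
by case: leP => _ //; right; exists s.
Qed.

Lemma edge_walk_length_gt0 x s :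
  path (edge w) x s -> x != last x s -> 0 < walk_length w x s.
Proof.
case: s => [|y s]; first by rewrite eqxx.
by move=> /= /andP[xy ys] _; rewrite ltr_pwDl// walk_length_ge0.
Qed.

Lemma path_metric_finite : finite_metric path_metric.
Proof.
have ge0 x y : 0 <= path_metric x y.
  have [->|[s [ps _ ->]]] := path_metricP x y; first exact: ltW.
  exact: walk_length_ge0.
have sym_le x y : path_metric y x <= path_metric x y.
  have [->|[s [ps <- ->]]] := path_metricP x y; first exact: path_metric_leM.
  have := path_metric_le (path_rev w_sym ps).
  by rewrite last_rev_belast walk_length_rev.
split.
- move=> x; apply/eqP; rewrite eq_le ge0 andbT.
  exact: (@path_metric_le x [::]).
- move=> x y; have [->|[s [ps ls ->]]] := path_metricP x y.
    by move=> M0; move: M_gt0; rewrite M0 ltxx.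
  move=> s0; apply/eqP; apply: contraT; rewrite -ls.
  by move/(edge_walk_length_gt0 ps); rewrite s0 ltxx.
- by move=> x y; apply/eqP; rewrite eq_le !sym_le.
- move=> y x z; have [->|[s [ps ls ->]]] := path_metricP x y.
    by rewrite (le_trans (path_metric_leM _ _))// lerDl.
  have [->|[t [pt lt ->]]] := path_metricP y z.
    by rewrite (le_trans (path_metric_leM _ _))// lerDr walk_length_ge0.
  rewrite -lt -ls -last_cat -walk_length_cat; apply: path_metric_le.
  by rewrite cat_path ps ls.
Qed.

Lemma path_metric_perm (g : {perm V}) :
  (forall x y, w (g x) (g y) = w x y) ->
  forall x y, path_metric (g x) (g y) = path_metric x y.
Proof.
have le (h : {perm V}) : (forall x y, w (h x) (h y) = w x y) ->
    forall x y, path_metric (h x) (h y) <= path_metric x y.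
  move=> hw x y; have [->|[s [ps <- ->]]] := path_metricP x y.
    exact: path_metric_leM.
  have hs : path (edge w) (h x) (map h s) /\
            walk_length w (h x) (map h s) = walk_length w x s.
    elim: s x ps => //= z s IH x /andP[xz zs].
    have e : edge w (h x) (h z) by rewrite /edge hw.
    by have [-> ->] := IH _ zs; rewrite hw e.
  by have := path_metric_le hs.1; rewrite last_map hs.2.
move=> gw x y; apply/eqP; rewrite eq_le le//=.
have := @le (g^-1)%g _ (g x) (g y); rewrite !permK; apply.
by move=> u v; rewrite -gw !permKV.
Qed.

Lemma path_metric_weight x y :
  w x x = 0 -> 0 <= w x y <= M -> no_shortcut w n -> (w x y = 0 -> x = y) ->
  path_metric x y = w x y.
Proof.
move=> wxx /andP[w0 wM] wn wxy; apply/eqP; rewrite eq_le; apply/andP; split.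
  have [e|ne] := eqVneq (w x y) 0.
    by rewrite -(wxy e) wxx; exact: (@path_metric_le x [::]).
  have e : path (edge w) x [:: y] by rewrite /= andbT /edge lt_def ne.
  by have := path_metric_le e; rewrite /= addr0.
have [->//|[s [ps ls ->]]] := path_metricP x y.
have [sn|sn] := leqP (size s) n; first by rewrite -ls wn.
apply: le_trans wM _; apply: le_trans M_le _.
apply: le_trans (walk_length_ge delta_le ps).
by rewrite ler_wpMn2l ?(ltW delta_gt0)// ltnW.
Qed.

(** A nonzero value below [M] is a sum of weights, at least the first of them, so
it lies in [T] between two elements of [S]. *)
Lemma path_metric_convex (T S : R -> Prop) :
  (forall x y, T x -> T y -> T (x + y)) -> (forall x, S x -> T x) ->
  (forall x y z, T x -> T y -> T z -> x <= y -> y <= z -> S x -> S z -> S y) ->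
  S 0 -> S M -> (forall x y, edge w x y -> S (w x y)) ->
  forall x y, S (path_metric x y).
Proof.
move=> TD ST Sconv S0 SM Sw x y.
have := path_metric_leM x y.
have [->//|[s [ps _ ->]]] := path_metricP x y.
case: s ps => [//|z s] /= /andP[xz zs] leM.
have Twalk u t : path (edge w) u t -> t != [::] -> T (walk_length w u t).
  elim: t u => // v t IH u /= /andP[/Sw/ST uv vt] _.
  by case: t IH vt => [|v' t] IH vt; rewrite ?addr0//; apply: TD => //; exact: IH.
apply: (Sconv (w x z) _ M) => //; [exact/ST/Sw| |exact: ST| |exact: Sw].
- by apply: (Twalk x (z :: s)); rewrite //= xz.
- by rewrite lerDl walk_length_ge0.
Qed.

End PathMetric.

(** * The extension property for finite metric spaces *)

(** If all distances vanish, [A] has at most one point and is its own extension.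
Otherwise [delta] is the least positive distance, [M] the largest one, and
walks with more than [M / delta] edges cannot be shortcuts. *)
Lemma finite_metric_extension (R : archiRealFieldType) (T S : R -> Prop)
    (A : finType) (d : A -> A -> R) :
  (forall x y, T x -> T y -> T (x + y)) -> (forall x, S x -> T x) ->
  (forall x y z, T x -> T y -> T z -> x <= y -> y <= z -> S x -> S z -> S y) ->
  S 0 -> finite_metric d -> (forall a b, S (d a b)) ->
  exists (B : finType) (dB : B -> B -> R) (i : A -> B),
    [/\ finite_metric dB, forall x y, S (dB x y) & extends_isometries d dB i].
Proof.
move=> TD ST Sconv S0 dM dS.
have d_ge0 := fm_ge0 dM.
have [ab0|] := pickP (fun ab : A * A => 0 < d ab.1 ab.2); last first.
  move=> d0; exists A, d, id; split=> //; split=> // D f _.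
  exists 1%g => [x y|a _]; rewrite !perm1//; apply: (fm_eq0 dM); apply/eqP.
  by rewrite eq_le d_ge0 andbT leNgt (d0 (a, f a)).
move=> ab0_gt0.
case: (@arg_minP _ R _ ab0 (fun ab => 0 < d ab.1 ab.2)
  (fun ab => d ab.1 ab.2) ab0_gt0) => -[a1 b1] /= d1_gt0 d1_le.
case: (@arg_maxP _ R _ ab0 predT (fun ab => d ab.1 ab.2) isT) => -[a2 b2] /= _ d2_ge.
pose delta := d a1 b1; pose M := d a2 b2.
have leM a b : d a b <= M by exact: (d2_ge (a, b)).
have M_gt0 : 0 < M by apply: lt_le_trans (leM a1 b1).
pose n := Num.bound (M / delta).
have M_le : M <= delta *+ n.
  rewrite -mulr_natl -ler_pdivrMr//; apply/ltW/archi_boundP.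
  by rewrite divr_ge0// ltW.
have [B [w [i [wG wE wn]]]] := extension_no_shortcut dM n.
have w_edge x y : edge w x y -> exists a b, w x y = d a b.
  by rewrite /edge; case: (wb_values wG x y) => [->|//]; rewrite ltxx.
have delta_le x y : edge w x y -> delta <= w x y.
  move=> xy; have [a [b e]] := w_edge x y xy.
  by rewrite e; apply: (d1_le (a, b)); rewrite /= -e.
have w_sym := wb_sym wG.
exists B, (path_metric w n M), i; split.
- exact: path_metric_finite w_sym M_gt0 d1_gt0 delta_le M_le.
- apply: path_metric_convex TD ST Sconv S0 _ _; first exact: dS.
  by move=> x y /w_edge[a [b ->]].
- split.
    move=> a b; rewrite (path_metric_weight d1_gt0)// ?(ei_embed wE)//.
    + exact: fm_refl dM a.
    + by rewrite d_ge0 leM.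
    + by move/(fm_eq0 dM) ->.
  move=> D f fD; have [g gw gf] := ei_extend wE fD.
  exists g => // x y.
  exact: (path_metric_perm d1_gt0 delta_le M_le gw).
Qed.

(** * Transport into the Urysohn space *)

Local Open Scope classical_set_scope.

(** An alias of [V] indexed by the proof that [d] is a metric, so that the
metric structure below can be inferred from the type. *)
Definition metric_copy (R : realType) (V : choiceType) (d : V -> V -> R)
  (dM : finite_metric d) : Type := V.

Section MetricCopy.
Context (R : realType) (V : choiceType) (d : V -> V -> R).
Hypothesis dM : finite_metric d.

HB.instance Definition _ := Choice.on (metric_copy dM).

HB.instance Definition _ := @isMetric.Build R (metric_copy dM) d
  (fm_refl dM) (fm_eq0 dM) (fm_sym dM) (fm_triangle dM).

End MetricCopy.

Lemma universal_finite (R : realType) (S : set R) (X : metricType R)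
    (V : finType) (d : V -> V -> R) :
  universal_for S X -> finite_metric d -> (forall x y, S (d x y)) ->
  exists h : V -> X, forall x y, mdist (h x) (h y) = d x y.
Proof.
move=> XU dM dS; pose Y : metricType R := metric_copy dM.
have [||U [h [_ hd]]] := XU Y.
- exists [set: Y]; last by move=> O [x Ox] _; exists x.
  exact: (@countableP V).
- exact: dS.
- by exists h => x y; rewrite hd.
Qed.

(** A correspondence between two finite families that preserves distances is
well defined on points, because points at distance [0] coincide. *)
Lemma isometry_between_families (R : realType) (X : metricType R)
    (I : finType) (u v : I -> X) :
  (forall a b, mdist (u a) (u b) = mdist (v a) (v b)) ->
  exists2 f : X -> X, isometry_onto (range u) (range v) f &
    forall a, f (u a) = v a.
Proof.
move=> uv.
have uvE a b : u a = u b -> v a = v b.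
  by move=> e; apply: mdist_positivity; rewrite -uv e mdistxx.
have vuE a b : v a = v b -> u a = u b.
  by move=> e; apply: mdist_positivity; rewrite uv e mdistxx.
pose f x := if [pick a | u a == x] is Some a then v a else x.
have fE a : f (u a) = v a.
  by rewrite /f; case: pickP => [b /eqP/uvE//|/(_ a)]; rewrite eqxx.
exists f => //; split; first split.
- by move=> _ [a _ <-]; rewrite fE; exists a.
- by move=> x y /[!inE] -[a _ <-] [b _ <-]; rewrite !fE => /vuE.
- by move=> _ [a _ <-]; exists (u a) => //; exists a.
- by move=> _ _ [a _ <-] [b _ <-]; rewrite !fE uv.
Qed.

Theorem theorem7p5 (R : realType) (T S : set R) (US : metricType R)
    (hT : additive_subsemigroup T) (hS : convex_subset T S) (hS0 : S 0%R)
    (hUS : is_Urysohn_space S US) :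
  Hrushovski_Solecki_Vershik US.
Proof.
move=> Y /finite_seqP[s Ys].
pose A : finType := seq_sub s.
pose d (a b : A) : R := mdist (val a) (val b).
have dM : finite_metric d.
  split=> [a|a b|a b|b a c].
  - exact: mdistxx.
  - by move/mdist_positivity/val_inj.
  - exact: metric_sym.
  - exact: metric_triangle.
have dS a b : S (d a b) by exact: Urysohn_distances hUS _ _.
have [B [dB [i [dBM dBS iE]]]] := finite_metric_extension hT hS.1 hS.2 hS0 dM dS.
have [h hd] := universal_finite (Urysohn_universal hUS) dBM dBS.
(* The embedded copy of A is moved onto Y by an isometry of the whole space. *)
have [f0 f0iso f0E] := @isometry_between_families R US A (h \o i) val
  (fun a b => etrans (hd _ _) (ei_embed iE a b)).
have [g [[_ gd] gE]] := Urysohn_ultrahomogeneous hUS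
  (finite_image _ finite_finset) (finite_image _ finite_finset) f0iso.
pose k := g \o h.
have kd x y : mdist (k x) (k y) = dB x y by rewrite -hd gd.
have kE a : k (i a) = val a by rewrite /k /= gE ?f0E//; exists a.
exists (range k); split; first exact: finite_image.
  move=> y; rewrite Ys /= => ys; exists (i (SeqSub ys)) => //.
move=> A1 B1 f A1Y B1Y [[fA1 _ _] fd].
have fY x : A1 x -> f x \in s by move=> /fA1/B1Y; rewrite Ys.
pose D : {set A} := [set a | `[< A1 (val a) >]]%SET.
have inD a : a \in D -> A1 (val a) by rewrite inE => /asboolP.
(* The partial isometry f of Y, read on A; outside D the default a is harmless. *)
pose phi (a : A) : A := insubd a (f (val a)).
have phiE a : a \in D -> val (phi a) = f (val a).
  by move=> /inD/fY fs; rewrite insubdK.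
have phid : {in D &, forall a b, d (phi a) (phi b) = d a b}.
  by move=> a b aD bD; rewrite /d !phiE// fd//; exact: inD.
have [gam gamd gamE] := ei_extend iE phid.
have [G Giso GE] := @isometry_between_families R US B k (k \o gam)
  (fun a b => etrans (kd a b) (esym (etrans (kd _ _) (gamd a b)))).
exists G; split.
  suff {2}-> : range k = range (k \o gam) by [].
  apply/seteqP; split => _ [b _ <-]; last by exists (gam b).
  by exists (gam^-1 b)%g => //=; rewrite permKV.
move=> x A1x; have xs : x \in s by have := A1Y _ A1x; rewrite Ys.
pose a : A := SeqSub xs.
have aD : a \in D by rewrite inE; exact/asboolP.
by rewrite -[x in LHS](kE a : _ = x) GE /= gamE// kE phiE.
Qed.
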